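(* Let $G$ and $H$ be groups, let $(g,h) \in G \times H$, and let $n \geq 1$ be an integer. Then the following hold (as equalities of subsets of $G \times H$): 1. $R_n(G \times H) = R_n(G) \times R_n(H)$; 2. $R_n(G \times H, (g,h)) = R_n(G,g) \times R_n(H,h)$.
   Context: For elements $x,y$ of a group $K$, the commutator is $[x,y] = x^{-1}y^{-1}xy$. The $n$-Engel word is defined recursively by $[x,{}_1\, y] = [x,y]$ and $[x,{}_n\, y] = [[x,{}_{n-1}\, y],y]$ for $n \geq 2$. For a group $K$ and an element $k \in K$, the set of right $n$-Engel elements of $K$ with the element $k$ is $R_n(K,k) = \{a \in K \mid [a,{}_n\, k] = 1\}$. The set of right $n$-Engel elements of $K$ is $R_n(K) = \{a \in K \mid [a,{}_n\, k] = 1 \text{ for all } k \in K\}$. These definitions are applied with $K = G$, $K = H$ and $K = G \times H$ (the direct product group, with identity $(1,1)$). On the right-hand sides, $\times$ denotes the Cartesian product of subsets of $G$ and $H$. *)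

(* Defs.v *)
From mathcomp Require Export all_boot.
From mathcomp Require Export classical_sets.

Set Implicit Arguments.
Unset Strict Implicit.
Unset Printing Implicit Defensive.

Local Open Scope group_scope.
Local Open Scope classical_set_scope.

(* The word [x,_n y] is only meant for n >= 1; the value x at n = 0 makes
   [x,_1 y] reduce to [~ x, y], i.e. x^-1 * (y^-1 * (x * y)). *)
Fixpoint engel (K : groupType) (x : K) (n : nat) (y : K) : K :=
  if n is m.+1 then [~ engel x m y, y] else x.

Definition right_engel_at (K : groupType) (n : nat) (k : K) : set K :=
  [set a | engel a n k = 1].

Definition right_engel (K : groupType) (n : nat) : set K :=
  [set a | forall k : K, engel a n k = 1].
Arguments right_engel K n : clear implicits.

(* Main.v *)
Require Import Defs.

(** Operations in [G * H] are coordinatewise, so an Engel word in pairs is the pair of Engel words,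
    and it is trivial exactly when both coordinates are. Quantifying over pairs then amounts to
    quantifying over each factor separately. *)

Lemma engel_pair (G H : groupType) (x y : G * H) (n : nat) :
  engel x n y = (engel x.1 n y.1, engel x.2 n y.2).
Proof. by elim: n => [|n IHn] /=; [case: x | rewrite IHn]. Qed.

Local Open Scope classical_set_scope.

Theorem theorem4 (G H : groupType) (g : G) (h : H) (n : nat) (hn : (1 <= n)%N) :
  right_engel (G * H)%type n = right_engel G n `*` right_engel H n /\
  right_engel_at n (g, h) = right_engel_at n g `*` right_engel_at n h.
Proof.
split; apply/seteqP; split=> -[a b] /=; rewrite /right_engel /right_engel_at /=.
- move=> Eab; split=> k.
    (* The entry 1 is mere padding to make [k] a pair: only the coordinate of [k] is read off. *)
    by have := Eab (k, 1%g); rewrite engel_pair => -[].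
  by have := Eab (1%g, k); rewrite engel_pair => -[].
- by move=> [Ea Eb] [k l]; rewrite engel_pair /= Ea Eb.
- by rewrite engel_pair => -[].
- by move=> [Ea Eb]; rewrite engel_pair /= Ea Eb.
Qed.
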